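(* Let $X$ be a compact Hausdorff space, $\mathcal{E}\to X$ a continuous (i.e. (F)) Banach bundle, and $\mathcal{F}\le\mathcal{E}$ a locally trivial subbundle of finite rank. Then the quotient bundle $\mathcal{E}/\mathcal{F}$ is again a continuous (i.e. (F)) Banach bundle.
   Context: An (H) Banach bundle over $X$ is a continuous open surjection $\pi:\mathcal{E}\to X$ whose fibers $\mathcal{E}_x:=\pi^{-1}(x)$ are complex Banach spaces, such that: scalar multiplication and fiberwise addition are continuous; the norm $\mathcal{E}\to\mathbb{R}$ is upper semicontinuous; and for every $x\in X$ the sets $\{s\in\mathcal{E} : \pi(s)\in U,\ \|s\|<\varepsilon\}$ ($U$ a neighborhood of $x$, $\varepsilon>0$) form a fundamental system of neighborhoods of $0_x\in\mathcal{E}_x$. It is continuous, or (F), if moreover the norm is continuous. A subbundle $\mathcal{F}\le\mathcal{E}$ is a family of closed subspaces $\mathcal{F}_x\le\mathcal{E}_x$, $x\in X$, whose union is an (H) Banach bundle with the topology and projection inherited from $\mathcal{E}$. The quotient bundle is $\mathcal{E}/\mathcal{F}:=\coprod_{x\in X}\mathcal{E}_x/\mathcal{F}_x$ with the quotient topology from $\mathcal{E}$ and the quotient norms on fibers; it is always an (H) Banach bundle. A bundle is locally trivial of finite rank if $X$ is covered by open sets $U$ over which it is isomorphic, via a fiberwise linear homeomorphism over $U$, to $U\times E$ with $E$ a finite-dimensional Banach space. *)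

(* Defs.v *)
From HB Require Import structures.
From mathcomp Require Import all_boot all_order all_algebra.
From mathcomp Require Import generic_quotient ring_quotient complex.
From mathcomp Require Import all_classical all_reals all_analysis.

Set Implicit Arguments.
Unset Strict Implicit.
Unset Printing Implicit Defensive.

Import Order.TTheory GRing.Theory Num.Theory.
Import numFieldNormedType.Exports.

Local Open Scope classical_set_scope.
Local Open Scope complex_scope.
Local Open Scope ring_scope.

(* The norm of a normed R[i]-module takes its values in R[i] (they are
   nonnegative reals there); rnorm is the same norm with values in R. *)
Definition rnorm (R : realType) (V : normedModType R[i]) (v : V) : R :=
  complex.Re `|v|.

Definition finite_dim (K : fieldType) (V : lmodType K) : Prop :=
  exists (n : nat) (b : 'I_n -> V),
    forall v, exists c : 'I_n -> K, v = \sum_(i < n) c i *: b i.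

(* The axiom of completeType, as a predicate. *)
Definition is_complete (K : numFieldType) (V : normedModType K) : Prop :=
  forall G : set_system V, ProperFilter G -> cauchy G -> cvg G.

Definition upper_semicontinuous (T : topologicalType) (R : realType)
    (f : T -> R) : Prop :=
  forall t a, f t < a -> \forall u \near t, f u < a.

Section ClosedSubspaces.
Context {R : realType} {V : normedModType R[i]}.

Record closedSubspace := ClosedSubspace {
  csub :> {pred V} ;
  csub_submod : submod_closed csub ;
  csub_closed : closed [set v : V | v \in csub]
}.

HB.instance Definition _ (F : closedSubspace) := GRing.isSubmodClosed.Build
  R[i] V (csub F) (GRing.submod_closed_semi (csub_submod F)).

Variable F : closedSubspace.

Lemma rnormE (v : V) : `|v| = (rnorm v)%:C.
Proof.
move: (normr_ge0 v); rewrite /rnorm; case: `|v| => a b.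
by rewrite lecE /= => /andP[/eqP -> _].
Qed.

Lemma rnorm_ge0 (v : V) : 0 <= rnorm v.
Proof. by rewrite -lecR -rnormE normr_ge0. Qed.

Record subspace_of := SubspaceOf {
  subv : V ;
  subv_in : subv \in csub F
}.

HB.instance Definition _ := [isSub for subv].
HB.instance Definition _ := [Choice of subspace_of by <:].
HB.instance Definition _ := [SubChoice_isSubLmodule of subspace_of by <:].

Let sub_norm (u : subspace_of) : R[i] := `|\val u|.

Let sub_normD u v : sub_norm (u + v) <= sub_norm u + sub_norm v.
Proof. by rewrite /sub_norm raddfD ler_normD. Qed.

Let sub_normZ (l : R[i]) u : sub_norm (l *: u) = `|l| * sub_norm u.
Proof. by rewrite /sub_norm linearZ normrZ. Qed.

Let sub_norm0_eq0 u : sub_norm u = 0 -> u = 0.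
Proof. by move=> /normr0_eq0 u0; apply: val_inj; rewrite u0 raddf0. Qed.

HB.instance Definition _ := Lmodule_isNormed.Build R[i] subspace_of
  sub_normD sub_normZ sub_norm0_eq0.

Local Open Scope quotient_scope.

Definition quotient_by : Type := (Quotient.quot (csub F)).

HB.instance Definition _ := GRing.Zmodule.on quotient_by.

Definition qclass (v : V) : quotient_by := \pi_(Quotient.quot (csub F)) v.

Lemma qclassP (a : quotient_by) : exists v, qclass v = a.
Proof. by exists (repr (a : (Quotient.quot (csub F)))); rewrite /qclass reprK. Qed.

Lemma qclass_eq u v : (qclass u = qclass v) <-> (u - v \in csub F).
Proof.
by rewrite (Quotient.idealrBE F); split => [/eqP|/eqP].
Qed.

Lemma qclassD u v : qclass (u + v) = qclass u + qclass v.
Proof. exact: (raddfD (\pi_(Quotient.quot (csub F)))). Qed.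

Lemma qclass0 : qclass 0 = 0.
Proof. exact: (raddf0 (\pi_(Quotient.quot (csub F)))). Qed.

Definition qscale (l : R[i]) (a : quotient_by) : quotient_by :=
  qclass (l *: repr (a : (Quotient.quot (csub F)))).

Lemma qclassZ l v : qclass (l *: v) = qscale l (qclass v).
Proof.
apply/qclass_eq; rewrite -scalerBr rpredZ//; apply/qclass_eq.
by rewrite {2}/qclass reprK.
Qed.

Let qscaleA l m a : qscale l (qscale m a) = qscale (l * m) a.
Proof. by have [v <-] := qclassP a; rewrite -!qclassZ scalerA. Qed.

Let qscale1 : left_id 1 qscale.
Proof. by move=> a; have [v <-] := qclassP a; rewrite -qclassZ scale1r. Qed.

Let qscaleDr : right_distributive qscale +%R.
Proof.
move=> l a b; have [u <-] := qclassP a; have [v <-] := qclassP b.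
by rewrite -qclassD -!qclassZ scalerDr qclassD.
Qed.

Let qscaleDl a : {morph qscale^~ a : l m / l + m}.
Proof.
by move=> l m; have [v <-] := qclassP a; rewrite -!qclassZ scalerDl qclassD.
Qed.

HB.instance Definition _ := GRing.Zmodule_isLmodule.Build R[i] quotient_by
  qscaleA qscale1 qscaleDr qscaleDl.

(* Quotient norm: the infimum of the norms of the representatives. *)
Definition qnorm (a : quotient_by) : R :=
  inf [set rnorm v | v in [set v | qclass v = a]].

Let qset_inf a : has_inf [set rnorm v | v in [set v | qclass v = a]].
Proof.
split; first by have [v va] := qclassP a; exists (rnorm v); exists v.
by exists 0 => _ [v _ <-]; exact: rnorm_ge0.
Qed.

Let qnorm_le v : qnorm (qclass v) <= rnorm v.
Proof. by apply: ge_inf; [case: (qset_inf (qclass v))|exists v]. Qed.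

Let qnorm_ge0 a : 0 <= qnorm a.
Proof.
apply: lb_le_inf; first by case: (qset_inf a).
by move=> _ [v _ <-]; exact: rnorm_ge0.
Qed.

Let qnorm_lt a e : 0 < e -> exists2 v, qclass v = a & rnorm v < qnorm a + e.
Proof.
by move=> e0; have [_ [v va <-] ve] := inf_adherent e0 (qset_inf a); exists v.
Qed.

Let qnormD a b : (qnorm (a + b))%:C <= (qnorm a)%:C + (qnorm b)%:C.
Proof.
rewrite -rmorphD/= lecR; apply/ler_addgt0Pr => e e0.
have e2 : 0 < e / 2 by rewrite divr_gt0.
have [u <- ue] := qnorm_lt a e2; have [v <- ve] := qnorm_lt b e2.
rewrite -qclassD (le_trans (qnorm_le _))//.
apply: (@le_trans _ _ (rnorm u + rnorm v)).
  by rewrite -lecR rmorphD/= -!rnormE ler_normD.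
by rewrite [e in leRHS](splitr e) addrACA lerD// ltW.
Qed.

Let normcE' (l : R[i]) : `|l| = (complex.Re `|l|)%:C.
Proof. by case: l => x y; rewrite normc_def. Qed.

Let qnormZ_le (l : R[i]) a : qnorm (l *: a) <= complex.Re `|l| * qnorm a.
Proof.
have l0 : 0 <= complex.Re `|l| by rewrite -lecR -normcE' normr_ge0.
apply/ler_addgt0Pr => e e0.
have d0 : 0 < e / (complex.Re `|l| + 1) by rewrite divr_gt0// ltr_wpDl.
have [v <- ve] := qnorm_lt a d0.
have -> : l *: qclass v = qclass (l *: v) by rewrite qclassZ.
rewrite (le_trans (qnorm_le _))//.
have -> : rnorm (l *: v) = complex.Re `|l| * rnorm v.
  apply/eqP; rewrite -(inj_eq (@complexI R)) rmorphM/= -!rnormE -normcE'.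
  by rewrite normrZ.
rewrite (le_trans (ler_wpM2l l0 (ltW ve)))// mulrDr lerD2l mulrCA.
by rewrite ler_piMr ?(ltW e0)// ler_pdivrMr ?mul1r ?lerDl// ltr_wpDl.
Qed.

Let qnormZ (l : R[i]) a : (qnorm (l *: a))%:C = `|l| * (qnorm a)%:C.
Proof.
rewrite normcE' -rmorphM; apply: (congr1 (real_complex R)); apply/eqP; rewrite eq_le qnormZ_le andTb.
have [->|l0] := eqVneq l 0.
  by rewrite normr0 /= mul0r qnorm_ge0.
have lp : 0 < complex.Re `|l| by rewrite -ltcR -normcE' normr_gt0.
have := qnormZ_le l^-1 (l *: a); rewrite scalerA mulVf// scale1r.
have -> : complex.Re `|l^-1| = (complex.Re `|l|)^-1.
  by apply: (@complexI R); rewrite -normcE' normfV [in LHS]normcE' -fmorphV.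
by rewrite ler_pdivlMl.
Qed.

Let qnorm0_eq0 a : (qnorm a)%:C = 0 -> a = 0.
Proof.
move=> /(@complexI R) a0; have [v va] := qclassP a.
rewrite -va -qclass0; apply/qclass_eq; rewrite subr0.
apply: (csub_closed (c := F)) => A /nbhs_ballP[e /= e0].
have ereal : e = (complex.Re e)%:C.
  by move: e0; rewrite ltcE /= => /andP[/eqP + _]; case: (e) => x y /= ->.
have e0' : 0 < complex.Re e by rewrite -ltcR -ereal.
move=> eA; have [w wa we] := qnorm_lt a e0'.
exists (v - w); split; first by apply/qclass_eq; rewrite va wa.
apply: eA; rewrite -ball_normE /ball_/= opprB addrC subrK.
by rewrite rnormE ereal ltcR; rewrite a0 add0r in we.
Qed.

HB.instance Definition _ := Lmodule_isNormed.Build R[i] quotient_by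
  qnormD qnormZ qnorm0_eq0.

End ClosedSubspaces.

Arguments closedSubspace {R} V.

(* A family of normed spaces over X, with a topology (given by its open sets)
   on the disjoint union of the fibers; the axioms of Banach bundles are in
   is_H_bundle below. *)
Record bundle (R : realType) (X : topologicalType) := Bundle {
  fiber :> X -> normedModType R[i] ;
  bopen : set_system {x : X & fiber x} ;
  bopenT : bopen setT ;
  bopenI : setI_closed bopen ;
  bopen_bigU : forall (I : Type) (f : I -> set {x : X & fiber x}),
    (forall i, bopen (f i)) -> bopen (\bigcup_i f i)
}.

(* An alias is needed: MathComp-Analysis equips {x : X & E x} itself with the
   disjoint union topology. *)
Definition total_space (R : realType) (X : topologicalType) (E : bundle R X) : Type :=
  {x : X & E x}.

HB.instance Definition _ (R : realType) (X : topologicalType) (E : bundle R X) :=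
  Choice.on (total_space E).
HB.instance Definition _ (R : realType) (X : topologicalType) (E : bundle R X) :=
  isOpenTopological.Build (total_space E)
    (@bopenT R X E) (@bopenI R X E) (@bopen_bigU R X E).

Section BanachBundles.
Context {R : realType} {X : topologicalType}.
Implicit Type E : bundle R X.

Definition bproj E (s : total_space E) : X := projT1 s.

Definition point_of E (x : X) (v : E x) : total_space E := existT _ x v.

Definition bnorm E (s : total_space E) : R := rnorm (projT2 s).

Definition bscale E (p : R[i]^o * total_space E) : total_space E :=
  point_of (p.1 *: projT2 p.2).

Definition fiber_pair E : Type := {x : X & (E x * E x)%type}.

HB.instance Definition _ E := Choice.on (fiber_pair E).

Definition fiber_pair_incl E (p : fiber_pair E) : total_space E * total_space E :=
  (point_of (projT2 p).1, point_of (projT2 p).2).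

Definition badd E (p : fiber_pair E) : total_space E :=
  point_of ((projT2 p).1 + (projT2 p).2).

(* Addition is defined on the fiber product, topologized as a subspace of
   total_space E * total_space E. *)
Record is_H_bundle E : Prop := {
  H_fiber_complete : forall x, is_complete (E x) ;
  H_proj_continuous : continuous (@bproj E) ;
  H_proj_open : forall U : set (total_space E), open U -> open (@bproj E @` U) ;
  H_proj_surj : forall x, exists s : total_space E, bproj s = x ;
  H_scale_continuous : continuous (@bscale E) ;
  H_add_continuous :
    continuous (@badd E : initial_topology (@fiber_pair_incl E) -> total_space E) ;
  H_norm_usc : upper_semicontinuous (@bnorm E) ;
  H_nbhs0 : forall (x : X) (A : set (total_space E)),
    nbhs (point_of (0 : E x)) A <->
    exists (U : set X) (e : R), [/\ nbhs x U, 0 < e &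
      [set s : total_space E | U (bproj s) /\ bnorm s < e] `<=` A]
}.

Definition is_F_bundle E : Prop := is_H_bundle E /\ continuous (@bnorm E).

Section SubAndQuotient.
Variables (E : bundle R X) (F : forall x : X, closedSubspace (E x)).

Definition sub_incl (s : {x : X & subspace_of (F x)}) : total_space E :=
  point_of (subv (projT2 s)).

Let sub_open : set_system {x : X & subspace_of (F x)} :=
  @open (initial_topology sub_incl).

Let sub_openT : sub_open setT.
Proof. exact: (@openT (initial_topology sub_incl)). Qed.

Let sub_openI : setI_closed sub_open.
Proof. exact: (@openI (initial_topology sub_incl)). Qed.

Let sub_open_bigU (I : Type) (f : I -> set {x : X & subspace_of (F x)}) :
  (forall i, sub_open (f i)) -> sub_open (\bigcup_i f i).
Proof.
by move=> fo; apply: (@bigcup_open (initial_topology sub_incl)) => i _; exact: fo.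
Qed.

Definition sub_bundle : bundle R X :=
  @Bundle R X (fun x => subspace_of (F x) : normedModType R[i])
    sub_open sub_openT sub_openI sub_open_bigU.

Definition quot_map (s : total_space E) : {x : X & quotient_by (F x)} :=
  existT _ (projT1 s) (qclass (F (projT1 s)) (projT2 s)).

Let quot_open : set_system {x : X & quotient_by (F x)} :=
  [set U | open (quot_map @^-1` U)].

Let quot_openT : quot_open setT.
Proof. by rewrite /quot_open /= preimage_setT; exact: openT. Qed.

Let quot_openI : setI_closed quot_open.
Proof. by move=> A B; exact: openI. Qed.

Let quot_open_bigU (I : Type) (f : I -> set {x : X & quotient_by (F x)}) :
  (forall i, quot_open (f i)) -> quot_open (\bigcup_i f i).
Proof. by move=> fo; apply: bigcup_open => i _; exact: fo. Qed.

Definition quot_bundle : bundle R X :=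
  @Bundle R X (fun x => quotient_by (F x) : normedModType R[i])
    quot_open quot_openT quot_openI quot_open_bigU.

(* The family F, with the topology and norms inherited from E, is a subbundle. *)
Definition is_subbundle : Prop := is_H_bundle sub_bundle.

End SubAndQuotient.

(* The trivialization over U is s |-> (bproj s, phi s), with inverse
   (x, v) |-> psi x v; the values of phi and psi outside U are irrelevant. *)
Definition locally_trivial_finite_rank E : Prop :=
  forall x0 : X, exists U : set X, [/\ open U, U x0 &
    exists (V : completeNormedModType R[i])
           (phi : forall x : X, E x -> V) (psi : forall x : X, V -> E x),
    [/\ finite_dim V,
        forall x, U x ->
          [/\ linear (phi x), cancel (phi x) (psi x) & cancel (psi x) (phi x)],
        {within @bproj E @^-1` U, continuous
          (fun s : total_space E => (bproj s, phi (bproj s) (projT2 s)) : X * V)} &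
        {within U `*` setT, continuous
          (fun p : X * V => point_of (psi p.1 p.2))}]].

End BanachBundles.

(* Main.v *)
(* The map q : E -> E/F is open: F is itself an H bundle, so its projection is
   open, and near s + f, with f in F, one can subtract nearby elements of F to
   come back close to s. Hence all the axioms of H bundles, including the upper
   semicontinuity of the norm, descend from E to E/F.

   For lower semicontinuity at q s0, let b_1, ..., b_n be a real basis of the
   model fiber of F, viewed in F through a trivialization. If a < |q s0|, then
     a |t| < | t s - c_1 b_1 - ... - c_n b_n |
   holds at s = s0 for all (t, c) <> 0 in R^(n+1): for t <> 0 this is the
   definition of the quotient norm, and for t = 0 it is the independence of the
   b_i. Both sides are homogeneous in (t, c), and the unit sphere of R^(n+1) is
   compact, so the inequality persists for s near s0; at t = 1 it gives
   a <= |q s|. *)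

Require Import Defs.
From mathcomp Require Import all_boot all_order all_algebra.
From mathcomp Require Import all_classical all_reals all_analysis.
From mathcomp Require Import complex lra.

Set Implicit Arguments.
Unset Strict Implicit.
Unset Printing Implicit Defensive.

Import Order.TTheory GRing.Theory Num.Theory.
Import numFieldNormedType.Exports.

Local Open Scope classical_set_scope.
Local Open Scope complex_scope.
Local Open Scope ring_scope.

(** * Real-valued norms on complex normed spaces *)

Lemma gt0_complexE (R : realType) (e : R[i]) :
  0 < e -> exists2 r : R, 0 < r & e = r%:C.
Proof.
case: e => x y; rewrite ltcE /= => /andP[/eqP -> x0].
by exists x.
Qed.

Section NormedModule.
Context {R : realType} {V : normedModType R[i]}.
Implicit Types u v : V.

Lemma rnormD u v : rnorm (u + v) <= rnorm u + rnorm v.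
Proof. by rewrite -lecR rmorphD/= -!rnormE ler_normD. Qed.

Lemma rnormN v : rnorm (- v) = rnorm v.
Proof. by rewrite /rnorm normrN. Qed.

Lemma rnormB u v : rnorm (u - v) = rnorm (v - u).
Proof. by rewrite /rnorm distrC. Qed.

Lemma rnormZ (x : R) v : rnorm (x%:C *: v) = `|x| * rnorm v.
Proof.
apply: (@complexI R); rewrite rmorphM/= -!rnormE normrZ; congr (_ * _).
by rewrite normc_def /= expr0n addr0 sqrtr_sqr.
Qed.

Lemma rnorm0 : rnorm (0 : V) = 0.
Proof. by rewrite /rnorm normr0. Qed.

Lemma rnorm_gt0 v : (0 < rnorm v) = (v != 0).
Proof. by rewrite -ltcR -rnormE normr_gt0. Qed.

Lemma ball_rnorm v (e : R) u : ball v e%:C u = (rnorm (v - u) < e) :> Prop.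
Proof. by rewrite -ball_normE /ball_/= rnormE ltcR. Qed.

Lemma nbhs_rnormP v (A : set V) :
  nbhs v A <-> exists2 e : R, 0 < e & forall u, rnorm (v - u) < e -> A u.
Proof.
split=> [/nbhs_ballP[e /= /gt0_complexE[r r0 ->] eA]|[e e0 eA]].
  by exists r => // u vu; apply: eA; rewrite ball_rnorm.
apply/nbhs_ballP; exists e%:C; first by rewrite /= ltcR.
by move=> u; rewrite ball_rnorm; exact: eA.
Qed.

End NormedModule.

(** * The quotient norm and completeness of quotients *)

Section QuotientNorm.
Context {R : realType} {V : normedModType R[i]} (F : closedSubspace V).

Lemma rnorm_qclass_le v : rnorm (qclass F v) <= rnorm v.
Proof.
apply: ge_inf; last by exists v.
by exists 0 => _ [w _ <-]; exact: rnorm_ge0.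
Qed.

Lemma rnorm_qclass_sub v f : f \in F -> rnorm (qclass F v) <= rnorm (v - f).
Proof.
move=> fF; have <- : qclass F (v - f) = qclass F v.
  by apply/qclass_eq; rewrite addrC addKr rpredN.
exact: rnorm_qclass_le.
Qed.

Lemma rnorm_qclass_lt (a : quotient_by F) e :
  rnorm a < e -> exists2 v, qclass F v = a & rnorm v < e.
Proof.
move=> ae; have /inf_lt[|_ [v va <-] ve] := ae; last by exists v.
by have [v va] := qclassP a; exists (rnorm v); exists v.
Qed.

Lemma qclassB u v : qclass F (u - v) = qclass F u - qclass F v.
Proof. by apply/eqP; rewrite eq_sym subr_eq -qclassD subrK. Qed.

Lemma qclass_scale (l : R[i]) v : qclass F (l *: v) = l *: qclass F v.
Proof. exact: qclassZ. Qed.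

(** Centres of balls of radius 2^-n belonging to the Cauchy filter lift to a Cauchy sequence in [V];
    the class of its limit is a limit of the filter. *)
Lemma quotient_complete : is_complete V -> is_complete (quotient_by F).
Proof.
move=> Vc G PG /(iffLR (cauchyP G)) cG.
have p0 n : 0 < (2^-1 ^+ n : R) by rewrite exprn_gt0// invr_gt0.
have /choice[a aG] n : exists a, G (ball a (2^-1 ^+ n : R)%:C).
  by apply: cG; rewrite ltcR.
have a_close n : rnorm (a n.+1 - a n) < 2 * 2^-1 ^+ n.
  have [w [/= + +]] := filter_ex (filterI (aG n.+1) (aG n)).
  rewrite !ball_rnorm => w1 w0.
  rewrite -(subrK w (a n.+1)) -addrA (le_lt_trans (rnormD _ _))//.
  rewrite mulr_natl mulr2n ltrD//; last by rewrite rnormB.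
  by rewrite (lt_le_trans w1)// exprS ler_piMl ?(ltW (p0 n))// invf_le1// ler1n.
have [v0 v0a] := qclassP (a 0).
(* A state is an index with a candidate lift. The estimate is required only when the candidate is a
   lift, so that every state has a successor; 0 is the default in the other case. *)
pose Rel (x y : nat * V) := y.1 = x.1.+1 /\
  (qclass F x.2 = a x.1 -> qclass F y.2 = a y.1 /\
     rnorm (y.2 - x.2) < 2 * 2^-1 ^+ x.1).
(* Lift the a n successively, so that the lifts form a Cauchy sequence. *)
have [|f [f0 fR]] := @dependent_choice _ Rel _ (0%N, v0).
  move=> [n v]; apply: cid; have [va|va] := pselect (qclass F v = a n); last first.
    by exists (n.+1, 0); split=> //=.
  have [w wa wn] := rnorm_qclass_lt (a_close n).
  exists (n.+1, v + w); split=> //= _.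
  by rewrite qclassD wa va addrC subrK addrAC subrr add0r.
have f1 n : (f n).1 = n.
  by elim: n => [|n IH]; rewrite ?f0// (fR n).1 IH.
pose v n := (f n).2.
have va n : qclass F (v n) = a n.
  rewrite -[in RHS](f1 n); elim: n => [|n IH]; first by rewrite /v f0.
  by have [_ /(_ IH)[]] := fR n.
have vS n : rnorm (v n.+1 - v n) < 2 * 2^-1 ^+ n.
  have [_] := fR n; rewrite f1 => /(_ (va n))[_]; exact.
(* Telescoping: the bound is the sum of 2 * 2^-k over n <= k < n + m. *)
have vD n m : rnorm (v (n + m)%N - v n) <= 4 * 2^-1 ^+ n - 4 * 2^-1 ^+ (n + m).
  elim: m => [|m IH]; first by rewrite addn0 !subrr rnorm0.
  rewrite addnS -(subrK (v (n + m)%N) (v _.+1)) -addrA.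
  rewrite (le_trans (rnormD _ _))// (le_trans (lerD (ltW (vS _)) IH))//.
  rewrite exprS; lra.
have vB n m : (n <= m)%N -> rnorm (v m - v n) < 4 * 2^-1 ^+ n.
  move=> /subnKC <-; rewrite (le_lt_trans (vD _ _))// ltrBlDr ltrDl.
  by rewrite mulr_gt0.
(* The factor 8 dominates both the 4 in [vB] and the radius 2^-n of the ball around [a n]. *)
have pcvg (e : R) : 0 < e -> \forall n \near \oo, (8 * 2^-1 ^+ n : R) < e.
  move=> e0; have e8 : 0 < e / 8 by rewrite divr_gt0.
  have : (fun n => 2^-1 ^+ n : R) @ \oo --> (0 : R).
    by apply: cvg_expr; rewrite ger0_norm ?invr_ge0// invf_lt1// ltr1n.
  move=> /cvgr0_norm_lt/(_ _ e8); apply: filterS => n.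
  by rewrite gtr0_norm// ltr_pdivlMr// mulrC.
have vcau : cauchy (v @ \oo).
  apply: cauchy_exP => _ /gt0_complexE[e e0 ->].
  near \oo => N.
  have Ne : 8 * 2^-1 ^+ N < e :> R by near: N; exact: pcvg.
  exists (v N); exists N => // m /= Nm.
  rewrite ball_rnorm rnormB (lt_trans (vB _ _ Nm))// (lt_trans _ Ne)//.
  by rewrite ltr_pM2r// ltr_nat.
have /cvg_ex[l vl] : cvg (v @ \oo) by apply: Vc.
apply/cvg_ex; exists (qclass F l) => A /nbhs_rnormP[e e0 eA].
have e2 : 0 < e / 2 by rewrite divr_gt0.
have vle : \forall n \near \oo, rnorm (l - v n) < e / 2.
  by apply: (vl [set w | rnorm (l - w) < e / 2]); apply/nbhs_rnormP; exists (e / 2).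
near \oo => N.
have vlN : rnorm (l - v N) < e / 2 by near: N.
have Ne : 8 * 2^-1 ^+ N < e / 2 by near: N; exact: pcvg.
apply: filterS (aG N) => w; rewrite ball_rnorm => aw; apply: eA.
rewrite -(subrK (a N) (qclass F l)) -addrA (le_lt_trans (rnormD _ _))//.
rewrite -va -qclassB [e]splitr ltrD//.
  by rewrite (le_lt_trans (rnorm_qclass_le _)).
rewrite va (lt_trans aw)//; have := p0 N; lra.
Unshelve. all: by end_near.
Qed.

End QuotientNorm.

(** * The quotient bundle is an (H) Banach bundle *)

Section QuotientBundle.
Context {R : realType} {X : topologicalType} {E : bundle R X}.
Variable F : forall x : X, closedSubspace (E x).
Hypothesis HE : is_H_bundle E.
Hypothesis HF : is_subbundle F.

Local Notation Q := (quot_bundle F).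
Local Notation q := (quot_map F : total_space E -> total_space Q).

Lemma quot_map_continuous : continuous q.
Proof. by apply/continuousP => A. Qed.

Lemma quot_map_point x (v : E x) :
  q (point_of v) = point_of (qclass (F x) v : Q x).
Proof. by []. Qed.

Lemma quot_map_surj (t : total_space Q) : exists s, q s = t.
Proof.
by case: t => x a; have [v <-] := qclassP a; exists (point_of v).
Qed.

(** Equal points of the quotient bundle have equal base points; transporting the lift into the fiber
    at [x] lets it be added to vectors there. *)
Lemma quot_map_lift x (v : E x) (s : total_space E) : q s = q (point_of v) ->
  exists2 u : E x, s = point_of u & qclass (F x) u = qclass (F x) v.
Proof.
case: s => y w sv; have yx : y = x := congr1 (@projT1 _ _) sv; subst y.
by exists w => //; exact: existT_inj2 sv.
Qed.

(** Unfolds the initial topology on pairs in a common fiber into product neighborhoods. *)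
Lemma nbhs_fiber_add x (u v : E x) (O : set (total_space E)) :
  nbhs (point_of (u + v)) O ->
  exists A B, [/\ nbhs (point_of u) A, nbhs (point_of v) B &
    forall y (u' v' : E y), A (point_of u') -> B (point_of v') ->
      O (point_of (u' + v'))].
Proof.
move=> /(H_add_continuous HE (x := existT _ x (u, v) : fiber_pair E)).
move=> [_ [[W Wo <-] /= Wuv WO]].
have [[A B] /= [Au Bv] ABW] : nbhs (point_of u, point_of v) W.
  exact: open_nbhs_nbhs.
exists A, B; split=> // y u' v' Au' Bv'.
by apply: (WO (existT _ y (u', v'))); exact: ABW.
Qed.

(** Subtraction is addition after scaling by -1, which is continuous. *)
Lemma nbhs_fiber_sub x (u v : E x) (O : set (total_space E)) :
  nbhs (point_of (u - v)) O ->
  exists A B, [/\ nbhs (point_of u) A, nbhs (point_of v) B &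
    forall y (u' v' : E y), A (point_of u') -> B (point_of v') ->
      O (point_of (u' - v'))].
Proof.
move=> /nbhs_fiber_add[A [B [Au Bv ABO]]].
have bscaleN1 y (w : E y) : bscale (-1, point_of w) = point_of (- w).
  by congr point_of; exact: scaleN1r.
have [[S C] /= [S1 Cv] SCB] :
    nbhs (-1 : R[i]^o, point_of v) (@bscale _ _ E @^-1` B).
  by apply: (H_scale_continuous HE); rewrite /= bscaleN1.
exists A, C; split=> // y u' v' Au' Cv'; apply: ABO => //.
have := SCB (-1, point_of v'); rewrite /preimage/= bscaleN1; apply.
by split=> //; exact: nbhs_singleton.
Qed.

(* Translating s by a local section of F: the projection of F is open, so over
   a neighborhood of the base point there are elements f of F for which s' - f
   stays close to s. *)
Lemma quot_map_open (A : set (total_space E)) : open A -> open (q @` A).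
Proof.
move=> Ao; suff qAo : open (q @^-1` (q @` A)) by [].
rewrite openE => -[x v] [[y w] Aw wv].
have [u su uv] := quot_map_lift wv; move: Aw; rewrite su => Au.
have fF : v - u \in F x by apply/qclass_eq.
have Auf : nbhs (point_of (v - (v - u))) A.
  by rewrite opprB addrC subrK; exact: open_nbhs_nbhs.
have [B [C [Bv Cf BCA]]] := nbhs_fiber_sub Auf.
move: Cf; rewrite nbhsE => -[C' [C'o C'f] C'C].
pose D : set (total_space (sub_bundle F)) := @sub_incl _ _ E F @^-1` C'.
have Do : open D by exists C'.
have pD := H_proj_open HF Do.
(* The image of [D] in the base is open and contains [x], so every fiber over a point near [x] has
   an element of [F] in [C]. *)
have Bx : nbhs (point_of v) (@bproj R X E @^-1` (@bproj _ _ _ @` D)).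
  apply: (H_proj_continuous HE); apply: open_nbhs_nbhs; split=> //.
  by exists (point_of (SubspaceOf fF : sub_bundle F x)).
apply: filterS (filterI Bv Bx) => -[z t] [/= Bt [[z' f] Df /= zz']].
rewrite /bproj /= in zz'; subst z'.
exists (point_of (t - subv f)).
  by apply: BCA => //; exact: C'C.
rewrite !quot_map_point; congr point_of; apply/qclass_eq.
by rewrite addrC addKr rpredN; exact: subv_in.
Qed.

Lemma quot_map_nbhs (s : total_space E) A : nbhs s A -> nbhs (q s) (q @` A).
Proof.
rewrite nbhsE => -[B [Bo Bs] BA]; apply: (filterS (image_subset q BA)).
by apply: open_nbhs_nbhs; split; [exact: quot_map_open|exists s].
Qed.

Lemma quot_scale_continuous : continuous (@bscale R X Q).
Proof.
move=> [l t] O; have [[x v] <-] := quot_map_surj t.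
have -> : bscale (l, q (existT _ x v)) = q (bscale (l, existT _ x v)).
  by rewrite /bscale /= quot_map_point qclass_scale.
move=> /quot_map_continuous/(H_scale_continuous HE)[[S A] /= [Sl Av] SAO].
exists (S, q @` A); first by split=> //; exact: quot_map_nbhs.
move=> [m _] [/= Sm [[y w] Aw <-]]; have := SAO (m, existT _ y w) (conj Sm Aw).
by rewrite /bscale /= quot_map_point qclass_scale.
Qed.

(** Representatives of two nearby classes are picked independently in [A] and [B]; [quot_map_lift]
    puts them in one fiber, where they can be added. *)
Lemma quot_add_continuous :
  continuous (@badd R X Q : initial_topology (@fiber_pair_incl R X Q) ->
                            total_space Q).
Proof.
move=> [x [a b]] O; have [u <-] := qclassP a; have [v <-] := qclassP b.
have -> : badd (existT _ x (qclass (F x) u, qclass (F x) v) : fiber_pair Q) =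
    q (point_of (u + v)).
  by rewrite /badd /= quot_map_point qclassD.
move=> /quot_map_continuous/nbhs_fiber_add[A [B [Au Bv ABO]]].
have : nbhs (existT _ x (qclass (F x) u, qclass (F x) v) :
    initial_topology (@fiber_pair_incl R X Q))
    (@fiber_pair_incl R X Q @^-1` (q @` A `*` q @` B)).
  apply: initial_continuous; exists (q @` A, q @` B) => //.
  by split; [exact: quot_map_nbhs Au|exact: quot_map_nbhs Bv].
apply: filterS => -[y [a' b']] [/= [s As sa] [t Bt tb]].
have [u' u'a] := qclassP a'; have [v' v'b] := qclassP b'.
have [w sw wa] : exists2 w : E y, s = point_of w & qclass (F y) w = a'.
  by rewrite -u'a; apply: quot_map_lift; rewrite sa -u'a.
have [z tz zb] : exists2 z : E y, t = point_of z & qclass (F y) z = b'.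
  by rewrite -v'b; apply: quot_map_lift; rewrite tb -v'b.
have /= : O (q (point_of (w + z))) by apply: ABO; rewrite -?sw -?tz.
by rewrite quot_map_point qclassD wa zb.
Qed.

Lemma bnorm_quot_map_le (s : total_space E) : bnorm (q s) <= bnorm s.
Proof. exact: rnorm_qclass_le. Qed.

Lemma bnorm_quot_map_lt (t : total_space Q) e :
  bnorm t < e -> exists2 s, q s = t & bnorm s < e.
Proof.
case: t => x a /(@rnorm_qclass_lt _ _ (F x) a)[v <- ve].
by exists (point_of v).
Qed.

(** Some representative has norm below [e], and so have its neighbors in [E]. Openness of the
    quotient map carries this neighborhood down, and passing to classes does not increase norms. *)
Lemma quot_norm_usc : upper_semicontinuous (@bnorm R X Q).
Proof.
move=> t e /bnorm_quot_map_lt[s <- se].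
apply: filterS (quot_map_nbhs (H_norm_usc HE se)) => _ [s' s'e <-].
exact: le_lt_trans (bnorm_quot_map_le s') s'e.
Qed.

Lemma quot_proj_continuous : continuous (@bproj R X Q).
Proof.
apply/continuousP => A Ao; suff : open (@bproj R X E @^-1` A) by [].
by move/continuousP: (H_proj_continuous HE); exact.
Qed.

Lemma quot_is_H_bundle : is_H_bundle Q.
Proof.
split.
- by move=> x; apply: quotient_complete; exact: H_fiber_complete.
- exact: quot_proj_continuous.
- move=> U Uo; have -> : @bproj _ _ Q @` U = @bproj _ _ E @` (q @^-1` U).
    rewrite eqEsubset; split=> _ [t + <-].
      by have [s <-] := quot_map_surj t => Us; exists s.
    by exists (q t).
  exact: (H_proj_open HE).
- by move=> x; exists (point_of (0 : Q x)).
- exact: quot_scale_continuous.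
- exact: quot_add_continuous.
- exact: quot_norm_usc.
(* One direction lifts a class of norm below [e] to a vector of norm below [e]; the other uses
   continuity of the projection and upper semicontinuity of the norm at zero. *)
- move=> x A; have q0 : q (point_of (0 : E x)) = point_of (0 : Q x).
    by rewrite quot_map_point qclass0.
  split=> [|[U [e [Ux e0 UeA]]]].
    rewrite -q0 => /quot_map_continuous/(H_nbhs0 HE)[U [e [Ux e0 UeA]]].
    exists U, e; split=> // t [/= + /bnorm_quot_map_lt[s st se]].
    by rewrite -st => Us; exact: UeA.
  apply: filterS UeA _; apply: filterI; first exact: quot_proj_continuous.
  by apply: quot_norm_usc; rewrite /bnorm /= rnorm0.
Qed.

End QuotientBundle.

(** * Real bases and compactness of the unit sphere *)

Section RealBasis.
Context {R : realType}.

Lemma real_complex_continuous : continuous (fun x : R => x%:C : R[i]^o).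
Proof.
move=> x A /nbhs_ballP[_ /= /gt0_complexE[e e0 ->] eA].
apply/nbhs_ballP; exists e => // y; rewrite -ball_normE /= => xy.
apply: eA; rewrite -ball_normE /= -rmorphB/= normc_def /= expr0n addr0.
by rewrite sqrtr_sqr ltcR.
Qed.

Definition real_comb (V : lmodType R[i]) n (b : 'I_n -> V) (c : 'I_n -> R) : V :=
  \sum_(i < n) (c i)%:C *: b i.

Lemma real_combZ (V : lmodType R[i]) n (b : 'I_n -> V) (x : R) c :
  real_comb b (fun i => x * c i) = x%:C *: real_comb b c.
Proof.
by rewrite /real_comb scaler_sumr; apply: eq_bigr => i _; rewrite rmorphM/= scalerA.
Qed.

Lemma real_comb_continuous (V : normedModType R[i]) m n (b : 'I_n -> V)
    (f : 'I_n -> 'I_m) :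
  continuous (fun c : 'rV[R]_m => real_comb b (fun i => c ord0 (f i))).
Proof.
rewrite /real_comb => c; apply: (cvg_big (@add_continuous V) (F := nbhs c)) => i _.
apply: (@cvgZr_tmp _ V _ _ _ (fun c : 'rV[R]_m => (c ord0 (f i))%:C : R[i]^o)).
apply: (@continuous_comp _ _ _ (fun c : 'rV[R]_m => c ord0 (f i))).
  exact: coord_continuous.
exact: real_complex_continuous.
Qed.

(** A complex spanning family together with its multiples by 'i spans over the reals. Real
    coefficients allow the compactness argument to run in ['rV[R]]. *)
Lemma finite_dim_real_basis (V : lmodType R[i]) : finite_dim V ->
  exists (n : nat) (b : 'I_n -> V),
    (forall v, exists c, v = real_comb b c) /\
    (forall c, real_comb b c = 0 -> forall i, c i = 0).
Proof.
move=> [n0 [b0 b0P]].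
pose P n := `[< exists b : 'I_n -> V, forall v, exists c, v = real_comb b c >].
have exP : exists n, P n.
  exists (n0 + n0)%N; apply/asboolP.
  exists (fun i => match fintype.split i with
    | inl j => b0 j | inr j => 'i *: b0 j end) => v.
  have [c ->] := b0P v.
  exists (fun i => match fintype.split i with
    | inl j => complex.Re (c j) | inr j => complex.Im (c j) end).
  rewrite /real_comb big_split_ord/= -big_split/=; apply: eq_bigr => i _.
  rewrite !(unsplitK (inl _)) !(unsplitK (inr _)) scalerA -scalerDl mulrC.
  by rewrite -complexE.
(* A spanning family of minimal size is independent. *)
case: (ex_minnP exP) => n /asboolP[b bP] nmin.
exists n, b; split=> // c c0 k; apply/eqP; apply: contraT => ck.
case: n => [|n] in b bP nmin c c0 k ck *; first by case: k ck.
suff /nmin : P n by rewrite ltnn.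
apply/asboolP; exists (b \o lift k) => v; have [d ->] := bP v.
(* The new coefficients come from eliminating [b k] through the relation [c0]. *)
exists (fun i => d (lift k i) - d k * (c k)^-1 * c (lift k i)).
move: c0; rewrite /real_comb (bigD1_ord k)//= => /eqP; rewrite addr_eq0 => /eqP ckb.
have bk : b k = - (c k)^-1%:C *: \sum_(i < n) (c (lift k i))%:C *: b (lift k i).
  rewrite scaleNr -scalerN -ckb scalerA -rmorphM/= mulVf//.
  by rewrite scale1r.
rewrite /real_comb (bigD1_ord k)//= bk !scaler_sumr -big_split/=.
apply: eq_bigr => i _; rewrite !scalerA -scalerDl; congr (_ *: _).
by rewrite rmorphB !rmorphM/= mulrN mulNr addrC.
Qed.

Lemma compact_unit_sphere n : compact [set c : 'rV[R]_n | `|c| = 1].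
Proof.
apply: bounded_closed_compact.
  by exists 1; split=> // x x1 c /= ->; exact: ltW.
have -> : [set c : 'rV[R]_n | `|c| = 1] =
  (fun c => `|c|) @^-1` [set x | x = 1] by [].
by apply: preimage_closed; [move=> x _; exact: norm_continuous|exact: closed_eq].
Qed.

End RealBasis.

Lemma continuous_pair (T U V : topologicalType) (f : T -> U) (g : T -> V) x :
  {for x, continuous f} -> {for x, continuous g} ->
  {for x, continuous (fun y => (f y, g y))}.
Proof. by move=> fc gc; exact: (cvg_pair fc gc). Qed.

(** * Lower semicontinuity of the quotient norm *)

Section NormLsc.
Context {R : realType} {X : topologicalType} {E : bundle R X}.
Variable F : forall x : X, closedSubspace (E x).
Hypothesis HE : is_F_bundle E.

Lemma sub_incl_continuous :
  continuous (@sub_incl _ _ E F : total_space (sub_bundle F) -> total_space E).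
Proof. by apply/continuousP => A Ao; exists A. Qed.

(** By contradiction: a representative of norm below [a] would violate the strict inequality on the
    sphere. This is why the bound obtained is non-strict. *)
Lemma near_le_bnorm_quot_map (s0 : total_space E) (a : R) :
  locally_trivial_finite_rank (sub_bundle F) ->
  a < bnorm (quot_map F s0 : total_space (quot_bundle F)) ->
  \forall s \near s0, a <= bnorm (quot_map F s : total_space (quot_bundle F)).
Proof.
move=> /(_ (bproj s0))[U [Uo Us0 [V [phi [psi [Vfin UP _ psic]]]]]] as0.
have [n [b [bspan bfree]]] := finite_dim_real_basis Vfin.
have psil x : U x -> linear (psi x).
  move=> /UP[phil phiK psiK] l v w; apply: (can_inj phiK).
  by rewrite phil !psiK.
have psi0 x : U x -> psi x 0 = 0.
  move=> Ux; apply: (addrI (psi x 0)).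
  by have := psil x Ux 1 0 0; rewrite !scale1r !addr0 => <-.
have psiZ x (l : R[i]) v : U x -> psi x (l *: v) = l *: psi x v.
  by move=> Ux; have := psil x Ux l v 0; rewrite psi0// !addr0.
have psi_eq0 x v : U x -> psi x v = 0 -> v = 0.
  by move=> Ux; rewrite -(psi0 x Ux); have [_ _ psiK] := UP x Ux => /(can_inj psiK).
have coord0_fst_continuous c s : {for (c, s), continuous
    (fun p : 'rV[R]_n.+1 * total_space E => p.1 ord0 ord0)}.
  apply: (@continuous_comp _ _ _ fst (fun c : 'rV[R]_n.+1 => c ord0 ord0)).
    exact: cvg_fst.
  exact: coord_continuous.
(* The coordinate 0 of c is the coefficient t of s. *)
pose L (c : 'rV[R]_n.+1) : V := real_comb b (fun i => c ord0 (lift ord0 i)).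
pose H (s : total_space E) (c : 'rV[R]_n.+1) : total_space E :=
  point_of ((c ord0 ord0)%:C *: projT2 s - subv (psi (bproj s) (L c))).
(* Joint continuity of [H] in both arguments, over [U] only, as [psi] is unconstrained elsewhere.
   The two terms of the difference are treated separately by [nbhs_fiber_sub]. *)
have Hc s c : U (bproj s) -> forall O, nbhs (H s c) O ->
    nbhs (c, s) [set p | O (H p.2 p.1)].
  move=> Us O /(nbhs_fiber_sub HE.1)[A [B [As Bs ABO]]].
  have hA : nbhs (c, s) [set p : 'rV[R]_n.+1 * total_space E |
      A (bscale ((p.1 ord0 ord0)%:C : R[i]^o, p.2))].
    pose g (p : 'rV[R]_n.+1 * total_space E) : R[i]^o * total_space E :=
      ((p.1 ord0 ord0)%:C, p.2).
    have gc : {for (c, s), continuous g}.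
      apply: continuous_pair; last exact: cvg_snd.
      apply: (@continuous_comp _ _ _ _ (fun x : R => x%:C : R[i]^o)); last first.
        exact: real_complex_continuous.
      exact: coord0_fst_continuous.
    exact: (@continuous_comp _ _ _ g _ (c, s) gc (H_scale_continuous HE.1 (x := _))).
  have hB : nbhs (c, s) [set p : 'rV[R]_n.+1 * total_space E | B (sub_incl
      (point_of (psi (bproj p.2) (L p.1)) : total_space (sub_bundle F)))].
    pose g (p : 'rV[R]_n.+1 * total_space E) := (bproj p.2, L p.1).
    have gc : {for (c, s), continuous g}.
      apply: continuous_pair.
        apply: (@continuous_comp _ _ _ snd (@bproj R X E)); first exact: cvg_snd.
        exact: (H_proj_continuous HE.1).
      apply: (@continuous_comp _ _ _ fst L); first exact: cvg_fst.
      exact: real_comb_continuous.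
    pose k (p : X * V) : total_space (sub_bundle F) := point_of (psi p.1 p.2).
    have kc : {for g (c, s), continuous k}.
      (* As [U] times [V] is open, continuity within it is continuity at each of its points. *)
      move: psic; rewrite continuous_open_subspace; last first.
        rewrite openE => -[x v] [/= Ux _]; exists (U, setT) => //.
        by split; [exact: open_nbhs_nbhs|exact: filterT].
      by apply; rewrite inE.
    have kgc := @continuous_comp _ _ _ g k (c, s) gc kc.
    exact: (@continuous_comp _ _ _ (k \o g) _ (c, s) kgc (@sub_incl_continuous _)).
  apply: filterS (filterI hA hB) => -[c' s'] [/= Ac' Bs'].
  exact: ABO.
have Hnear : \forall s \near s0,
    [set c : 'rV[R]_n.+1 | `|c| = 1] `<=`
    (fun c => a * `|c ord0 ord0| < bnorm (H s c)).
  (* Compactness reduces uniformity in [c] to a neighborhood of each pair [(c, s0)]. *)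
  apply: (iffLR (compact_near_coveringP _) (@compact_unit_sphere R n.+1) _
    (nbhs s0) (fun s c => a * `|c ord0 ord0| < bnorm (H s c))) => c c1.
  have Hs0c : a * `|c ord0 ord0| < bnorm (H s0 c).
    rewrite /bnorm /=; have [c0|c0] := eqVneq (c ord0 ord0) 0.
      rewrite c0 normr0 mulr0 scale0r sub0r rnormN rnorm_gt0.
      apply/eqP => psi00; have /(psi_eq0 _ _ Us0)/bfree cl0 :
          psi (bproj s0) (L c) = 0 by exact: val_inj.
      have c00 : c = 0.
        apply/rowP => j; rewrite mxE -(ord1 ord0).
        by case: (unliftP ord0 j) => [i|] ->; [exact: cl0|exact: c0].
      by move: c1; rewrite /= c00 normr0 => /eqP; rewrite eq_sym oner_eq0.
    (* Factoring out t leaves t (s0 - f) with f in [F], of norm at least |t| times the quotient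
       norm. *)
    have -> : L c = (c ord0 ord0)%:C *: ((c ord0 ord0)^-1%:C *: L c).
      by rewrite scalerA -rmorphM/= mulfV// scale1r.
    rewrite psiZ// -scalerBr rnormZ mulrC ltr_pM2l ?normr_gt0//.
    by rewrite (lt_le_trans as0)// rnorm_qclass_sub// subv_in.
  (* The midpoint separates the two sides, so that each can be controlled on its own. *)
  pose m := (a * `|c ord0 ord0| + bnorm (H s0 c)) / 2.
  have am : a * `|c ord0 ord0| < m by rewrite /m; lra.
  have mH : m < bnorm (H s0 c) by rewrite /m; lra.
  have /(Hc _ _ Us0) h1 : nbhs (H s0 c) [set s | m < bnorm s].
    by apply: (HE.2 (H s0 c) [set y | m < y]); exact: lt_nbhsr.
  have h2 : nbhs (c, s0) [set p : 'rV[R]_n.+1 * total_space E |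
      a * `|p.1 ord0 ord0| < m].
    have anc : continuous (fun x : R => a * `|x|).
      by move=> x; apply: continuousM; [exact: cst_continuous|exact: norm_continuous].
    have ac := continuous_comp (@coord0_fst_continuous c s0) (anc _).
    by apply: (ac [set y | y < m]); exact: lt_nbhsl.
  apply: filterS (filterI h1 h2) => -[c' s'] [/= mc' c'm].
  exact: lt_trans mc'.
have Unear : \forall s \near s0, U (bproj s).
  by apply: (H_proj_continuous HE.1); exact: open_nbhs_nbhs.
(* A representative [w] of norm below [a] differs from [v] by an element of [F], which has
   coordinates [c] in the real basis. *)
apply: filterS (filterI Hnear Unear) => -[x v] [Hs Us]; rewrite /bnorm /= leNgt.
apply/negP => /rnorm_qclass_lt[w /esym/qclass_eq fF wa].
have [c cE] := bspan (phi x (SubspaceOf fF)).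
(* Rescale (1, c) to the unit sphere. *)
pose d : 'rV[R]_n.+1 :=
  \row_j (if unlift ord0 j is Some i then c i else 1).
have d0 : 0 < `|d|.
  rewrite normr_gt0; apply/eqP => /rowP/(_ ord0).
  by rewrite !mxE unlift_none => /eqP; rewrite oner_eq0.
have d1 : `| `|d|^-1 *: d | = 1.
  by rewrite normrZ normfV normr_id mulVf// gt_eqF.
have d00 : (`|d|^-1 *: d) ord0 ord0 = `|d|^-1 by rewrite !mxE unlift_none mulr1.
have Ld : L (`|d|^-1 *: d) = `|d|^-1%:C *: phi x (SubspaceOf fF).
  rewrite /L cE -real_combZ; congr real_comb; apply/funext => i.
  by rewrite !mxE liftK.
(* Since v - (v - w) = w, the inequality at this point of the sphere reads a / |d| < |w| / |d|,
   against |w| < a. *)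
have Hd : H (existT _ x v) (`|d|^-1 *: d) = point_of (`|d|^-1%:C *: w).
  have [_ phiK _] := UP x Us.
  rewrite /H /= d00 Ld psiZ// phiK -scalerBr /=; congr point_of.
  by rewrite opprB addrC subrK.
have := Hs _ d1; rewrite Hd d00 /bnorm /= rnormZ mulrC ltr_pM2l.
  by rewrite ltNge (ltW wa).
by rewrite normr_gt0 invr_eq0 gt_eqF.
Qed.

End NormLsc.

Theorem theoremB (R : realType) (X : topologicalType)
    (E : bundle R X) (F : forall x : X, closedSubspace (E x)) :
  compact [set: X] -> hausdorff_space X ->
  is_F_bundle E ->
  is_subbundle F ->
  locally_trivial_finite_rank (sub_bundle F) ->
  is_F_bundle (quot_bundle F).
Proof.
move=> _ _ HE HF Ftriv; have HQ := quot_is_H_bundle HE.1 HF; split=> // t.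
have [s st] := quot_map_surj t; rewrite -st => A /nbhs_ballP[e /= e0 eA].
(* Halving [e] compensates for the non-strict lower bound. *)
have lt_t : bnorm t - e / 2 < bnorm (quot_map F s : total_space (quot_bundle F)).
  by rewrite st; lra.
(* The lower bound holds near [s] in [E], and openness of the quotient map transfers it to a
   neighborhood of [t]; the upper bound is upper semicontinuity. *)
have := quot_map_nbhs HE.1 HF (near_le_bnorm_quot_map HE Ftriv lt_t).
rewrite st; move: (H_norm_usc HQ (t := t) (a := bnorm t + e)).
rewrite ltrDl => /(_ e0) + lsc; move/filterI/(_ lsc).
apply: filterS => t' [/= t'1 [s' s'2 s't']].
move: t'1; rewrite -s't' => s'1; apply: eA; rewrite st.
by rewrite -ball_normE /= ltr_norml; apply/andP; split; lra.
Qed.
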